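(* Steady rotations of the reduced $n$-dimensional Veselova system in extremal principal planes are $G_R$-Lyapunov stable. That is, if $(q(t),p(t))$ is a steady rotation on $T^*\mathrm{S}^{n-1}$ taking place in an extremal principal plane, then the $G_R$-orbit of its trajectory is a $G_R$-Lyapunov stable subset of $T^*\mathrm{S}^{n-1}$.
   Context: Let $n\ge 2$ and $\mathbb{J}=\mathrm{diag}[J_1,\dots,J_n]$ with all $J_i>0$ (not necessarily distinct). $T^*\mathrm{S}^{n-1}=\{(q,p)\in\mathbb{R}^n\times\mathbb{R}^n:\|q\|=1,\ q\cdot p=0\}$. The reduced Veselova system is $$\dot q=C\left[p-\frac{p\cdot Cq}{q\cdot Cq}q\right],\quad \dot p=-2H(q,p)q,\quad C=(\mathbb{J}+(q\cdot\mathbb{J}q)\mathrm{Id}_n)^{-1},\quad H(q,p)=\tfrac12\left(p\cdot Cp-\tfrac{(p\cdot Cq)^2}{q\cdot Cq}\right).$$ $G_R=\{h\in\mathrm{O}(n):h\mathbb{J}h^{-1}=\mathbb{J}\}$ acts by $h\cdot(q,p)=(hq,hp)$, preserving the dynamics. A principal plane is a 2-dimensional $\mathbb{J}$-invariant subspace $\Pi\subset\mathbb{R}^n$; its moment of inertia $\mathrm{in}(\Pi)$ is the sum of the two eigenvalues of $\mathbb{J}|_\Pi$. $\Pi$ is extremal if either $\mathrm{in}(\Pi)\le\mathrm{in}(\Pi')$ for all principal planes $\Pi'$, or $\mathrm{in}(\Pi)\ge\mathrm{in}(\Pi')$ for all principal planes $\Pi'$. A steady rotation is a solution along which the angular velocity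 $\Omega=q\dot q^T-\dot q q^T$ is constant and nonzero; then $q(t),p(t)$ rotate uniformly in a fixed principal plane, the plane of the steady rotation. A $G_R$-invariant subset $S$ of phase space is $G_R$-Lyapunov stable if for every $G_R$-invariant neighbourhood $U$ of $S$ there is a $G_R$-invariant neighbourhood $V$ of $S$ such that any trajectory that intersects $V$ is entirely contained in $U$. *)

(* Defs.v *)
From HB Require Import structures.
From mathcomp Require Import all_boot all_order all_algebra.
From mathcomp Require Import all_classical all_reals all_analysis.

Set Implicit Arguments.
Unset Strict Implicit.
Unset Printing Implicit Defensive.

Import Order.TTheory GRing.Theory Num.Theory.
Import numFieldNormedType.Exports.

Local Open Scope classical_set_scope.
Local Open Scope ring_scope.

(* The inertia tensor is [diag_mx J] with [J : 'rV[R]_n];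
   points of phase space are pairs of column vectors. *)

Definition dot (R : realType) (n : nat) (u v : 'cV[R]_n) : R :=
  \sum_(i < n) u i 0 * v i 0.

(* The library norm on matrices is the sup norm. *)
Definition enorm (R : realType) (n : nat) (u : 'cV[R]_n) : R :=
  Num.sqrt (dot u u).

Definition phase_space (R : realType) (n : nat) :
    set ('cV[R]_n * 'cV[R]_n) :=
  [set x | enorm x.1 = 1 /\ dot x.1 x.2 = 0].
Arguments phase_space : clear implicits.

(* On the unit sphere the inverted matrix is diagonal with positive entries,
   so [invmx] is a genuine inverse there. *)
Definition Cmx (R : realType) (n : nat) (J : 'rV[R]_n) (q : 'cV[R]_n) :
    'M[R]_n :=
  invmx (diag_mx J + (dot q (diag_mx J *m q))%:M).

Definition energy (R : realType) (n : nat) (J : 'rV[R]_n)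
    (q p : 'cV[R]_n) : R :=
  let C := Cmx J q in
  2^-1 * (dot p (C *m p) - dot p (C *m q) ^+ 2 / dot q (C *m q)).

Definition veselova_q (R : realType) (n : nat) (J : 'rV[R]_n)
    (q p : 'cV[R]_n) : 'cV[R]_n :=
  let C := Cmx J q in
  C *m (p - (dot p (C *m q) / dot q (C *m q)) *: q).

Definition veselova_p (R : realType) (n : nat) (J : 'rV[R]_n)
    (q p : 'cV[R]_n) : 'cV[R]_n :=
  (- (2 * energy J q p)) *: q.

Definition solution_on (R : realType) (n : nat) (J : 'rV[R]_n) (I : set R)
    (q p : R -> 'cV[R]_n) : Prop :=
  forall t : R, I t ->
    [/\ phase_space R n (q t, p t),
        is_derive t 1 q (veselova_q J (q t) (p t)) &
        is_derive t 1 p (veselova_p J (q t) (p t))].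

Definition GR (R : realType) (n : nat) (J : 'rV[R]_n) : set 'M[R]_n :=
  [set h | h *m h^T = 1%:M /\ h *m diag_mx J *m invmx h = diag_mx J].

Definition act (R : realType) (n : nat) (h : 'M[R]_n)
    (x : 'cV[R]_n * 'cV[R]_n) : 'cV[R]_n * 'cV[R]_n :=
  (h *m x.1, h *m x.2).

Definition GR_invariant (R : realType) (n : nat) (J : 'rV[R]_n)
    (S : set ('cV[R]_n * 'cV[R]_n)) : Prop :=
  forall h : 'M[R]_n, GR J h ->
  forall x : 'cV[R]_n * 'cV[R]_n, S x -> S (act h x).

(* Subspaces of R^n are row spaces of square matrices, as in mxalgebra; a
   column vector v lies in Pi when (v^T <= Pi)%MS. As diag_mx J is symmetric,
   its right action on rows is its usual left action on columns. *)
Definition principal_plane (R : realType) (n : nat) (J : 'rV[R]_n)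
    (Pi : 'M[R]_n) : Prop :=
  \rank Pi = 2%N /\ stablemx Pi (diag_mx J).

(* The eigenvalues are counted with multiplicity, as roots of the
   characteristic polynomial of the restriction of diag_mx J to Pi. The
   default value 0 is irrelevant: the restriction is self-adjoint, hence its
   characteristic polynomial splits. *)
Definition plane_inertia (R : realType) (n : nat) (J : 'rV[R]_n)
    (Pi : 'M[R]_n) : R :=
  xget 0 [set m : R | exists a b : R,
    char_poly (restrictmx Pi (diag_mx J)) = ('X - a%:P) * ('X - b%:P)
    /\ m = a + b].

Definition extremal_plane (R : realType) (n : nat) (J : 'rV[R]_n)
    (Pi : 'M[R]_n) : Prop :=
  principal_plane J Pi /\
  ((forall Pi' : 'M[R]_n, principal_plane J Pi' ->
      plane_inertia J Pi <= plane_inertia J Pi') \/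
   (forall Pi' : 'M[R]_n, principal_plane J Pi' ->
      plane_inertia J Pi' <= plane_inertia J Pi)).

Definition angular_velocity (R : realType) (n : nat) (q : R -> 'cV[R]_n)
    (t : R) : 'M[R]_n :=
  q t *m (derive1 q t)^T - derive1 q t *m (q t)^T.

(* The vector field is complete on phase space (the energy is conserved and
   has compact level sets), so a maximal solution is defined on all of R. *)
Definition steady_rotation (R : realType) (n : nat) (J : 'rV[R]_n)
    (q p : R -> 'cV[R]_n) : Prop :=
  solution_on J [set: R] q p /\
  exists Om : 'M[R]_n,
    Om != 0 /\ forall t : R, angular_velocity q t = Om.

Definition takes_place_in (R : realType) (n : nat) (q p : R -> 'cV[R]_n)
    (Pi : 'M[R]_n) : Prop :=
  forall t : R, ((q t)^T <= Pi)%MS /\ ((p t)^T <= Pi)%MS.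

Definition GR_orbit (R : realType) (n : nat) (J : 'rV[R]_n)
    (q p : R -> 'cV[R]_n) : set ('cV[R]_n * 'cV[R]_n) :=
  [set x | exists (h : 'M[R]_n) (t : R), GR J h /\ x = act h (q t, p t)].

(* Neighbourhoods are relative to the subspace topology of phase space. *)
Definition phase_neighbourhood (R : realType) (n : nat)
    (S U : set ('cV[R]_n * 'cV[R]_n)) : Prop :=
  U `<=` phase_space R n /\
  exists O : set ('cV[R]_n * 'cV[R]_n),
    [/\ open O, S `<=` O & O `&` phase_space R n `<=` U].

(* Trajectories are solutions on arbitrary open intervals, maximal or not;
   every one of them is part of a maximal one, so this quantification agrees
   with the one over maximal solutions. *)
Definition GR_Lyapunov_stable (R : realType) (n : nat) (J : 'rV[R]_n)
    (S : set ('cV[R]_n * 'cV[R]_n)) : Prop :=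
  [/\ S `<=` phase_space R n,
      GR_invariant J S &
      forall U : set ('cV[R]_n * 'cV[R]_n),
        phase_neighbourhood S U -> GR_invariant J U ->
        exists V : set ('cV[R]_n * 'cV[R]_n),
          [/\ phase_neighbourhood S V,
              GR_invariant J V &
              forall (I : set R) (q p : R -> 'cV[R]_n),
                is_interval I -> open I -> solution_on J I q p ->
                (exists s : R, I s /\ V (q s, p s)) ->
                forall t : R, I t -> U (q t, p t)]].

(* Main.v *)
Require Import Defs.
From HB Require Import structures.
From mathcomp Require Import all_boot all_order all_algebra.
From mathcomp Require Import all_classical all_reals all_analysis.
From mathcomp Require Import ring lra.

Set Implicit Arguments.
Unset Strict Implicit.
Unset Printing Implicit Defensive.

Import Order.TTheory GRing.Theory Num.Theory.
Import numFieldNormedType.Exports.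

Local Open Scope classical_set_scope.
Local Open Scope ring_scope.

(** The energy [H] and the squared norm of the momentum [p] are conserved. Along
    a steady rotation in a principal plane of moment of inertia [m] they satisfy
    [2 m H = |p|^2], and if the plane is extremal this equation singles out,
    among the points with the same norm of [p], precisely the orbit of the
    trajectory under the symmetry group. The sum of the distances of [|p|^2] to
    its value [c2] on the trajectory and of [2 m H] to [|p|^2] is therefore a
    conserved, invariant function that vanishes on phase space exactly on the
    orbit. Its small sublevel sets are invariant under the flow, and they shrink
    to the orbit because the momentum is bounded on them
    ([conserved_stability]).

    The zero set is found in three moves.

    - The energy is the Legendre dual of the quadratic form of
      [J + (q . J q) Id] on the tangent space of the sphere ([energy_gap]). As
      the value of this form at a unit tangent vector [w] is
      [q . J q + w . J w], any one-sided bound on this quantity for orthonormal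
      pairs bounds [2 H] in terms of [|p|^2], and equality in the latter bound
      means equality in the former for the pair formed by [q] and the direction
      of [p] ([extremal_of_energy]).
    - For an orthonormal pair [q], [w] the quantity [q . J q + w . J w] is a
      weighted sum of the [J_i] with weights in the unit interval and total
      weight 2. It lies between the sums of the two smallest and of the two
      largest [J_i], which are the moments of inertia of coordinate planes
      ([coordinate_plane], [pair_inertia_le]). In case of equality the pair
      spans a plane built from the eigenspaces of the extreme eigenvalues
      ([pair_inertia_eq]).
    - Reflections in eigenvectors of [J] belong to the symmetry group. They
      carry one such pair to another as soon as the components along an extreme
      eigenvector with simple eigenvalue agree ([extremal_pairs_conjugate]). The
      steady rotation itself moves these components around the unit circle
      ([steady_coordinates]), so that every zero lies on the orbit. *)

(** * The Euclidean inner product *)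

Section InnerProduct.
Context {R : realType} {n : nat}.
Implicit Types (u v w : 'cV[R]_n) (a : R).

Lemma dotE u v : dot u v = (u^T *m v) 0 0.
Proof. by rewrite !mxE; apply: eq_bigr => i _; rewrite !mxE. Qed.

Lemma dotC u v : dot u v = dot v u.
Proof. by apply: eq_bigr => i _; rewrite mulrC. Qed.

Lemma dotDr u v w : dot u (v + w) = dot u v + dot u w.
Proof. by rewrite !dotE mulmxDr mxE. Qed.

Lemma dotZr a u v : dot u (a *: v) = a * dot u v.
Proof. by rewrite !dotE -scalemxAr mxE. Qed.

Lemma dotNr u v : dot u (- v) = - dot u v.
Proof. by rewrite !dotE mulmxN mxE. Qed.

Lemma dotBr u v w : dot u (v - w) = dot u v - dot u w.
Proof. by rewrite dotDr dotNr. Qed.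

Lemma dotDl u v w : dot (v + w) u = dot v u + dot w u.
Proof. by rewrite dotC dotDr !(dotC u). Qed.

Lemma dotZl a u v : dot (a *: v) u = a * dot v u.
Proof. by rewrite dotC dotZr (dotC u). Qed.

Lemma dotNl u v : dot (- v) u = - dot v u.
Proof. by rewrite dotC dotNr (dotC u). Qed.

Lemma dotBl u v w : dot (v - w) u = dot v u - dot w u.
Proof. by rewrite dotDl dotNl. Qed.

Lemma dot0l u : dot 0 u = 0.
Proof. by rewrite -(scale0r u) dotZl mul0r. Qed.

Lemma dot0r u : dot u 0 = 0.
Proof. by rewrite dotC dot0l. Qed.

Definition dot_linE := (dotDr, dotDl, dotNr, dotNl, dotZr, dotZl).

Lemma dot_mulmxr (A : 'M[R]_n) u v : dot u (A *m v) = dot (A^T *m u) v.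
Proof. by rewrite !dotE trmx_mul trmxK mulmxA. Qed.

Lemma dot_ge0 u : 0 <= dot u u.
Proof. by apply: sumr_ge0 => i _; rewrite -expr2 sqr_ge0. Qed.

Lemma dot_eq0 u : (dot u u == 0) = (u == 0).
Proof.
apply/eqP/eqP => [u0|->]; last exact: dot0l.
apply/matrixP => i j; rewrite ord1 mxE.
have /psumr_eq0P u0' := u0; apply/eqP; rewrite -sqrf_eq0 expr2.
by rewrite u0'// => k _; rewrite -expr2 sqr_ge0.
Qed.

Lemma dot_gt0 u : (0 < dot u u) = (u != 0).
Proof. by rewrite lt_neqAle dot_ge0 andbT eq_sym dot_eq0. Qed.

Lemma enorm1 u : enorm u = 1 <-> dot u u = 1.
Proof.
split=> [h|h]; last by rewrite /enorm h sqrtr1.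
by rewrite -[LHS]sqr_sqrtr ?dot_ge0// -/(enorm u) h expr1n.
Qed.

Lemma dot_delta i u : dot (delta_mx i 0) u = u i 0.
Proof.
rewrite /dot (bigD1 i)//= mxE !eqxx mul1r big1 ?addr0// => j ji.
by rewrite mxE (negbTE ji) mul0r.
Qed.

Lemma bessel_coord u w i : dot u u = 1 -> dot w w = 1 -> dot u w = 0 ->
  u i 0 ^+ 2 + w i 0 ^+ 2 <= 1.
Proof.
move=> uu ww uw.
have := dot_ge0 (delta_mx i 0 - u i 0 *: u - w i 0 *: w).
rewrite !dot_linE !(dotC _ (delta_mx i 0)) !dot_delta (dotC w u) uu ww uw.
by rewrite !mxE !eqxx /=; lra.
Qed.

End InnerProduct.

(** * The quadratic form of the inertia tensor *)

Section Inertia.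
Context {R : realType} {n : nat}.
Implicit Types (J : 'rV[R]_n) (u v w q p : 'cV[R]_n).

Lemma mulJE J u i : (diag_mx J *m u) i 0 = J 0 i * u i 0.
Proof. by rewrite mul_diag_mx !mxE. Qed.

Lemma jdotE J u v :
  dot u (diag_mx J *m v) = \sum_i J 0 i * (u i 0 * v i 0).
Proof. by apply: eq_bigr => i _; rewrite mulJE mulrCA. Qed.

Lemma jdotC J u v : dot u (diag_mx J *m v) = dot v (diag_mx J *m u).
Proof. by rewrite !jdotE; apply: eq_bigr => i _; rewrite (mulrC (u i 0)). Qed.

Lemma jdot_ge0 J (J_ge0 : forall i, 0 <= J 0 i) u :
  0 <= dot u (diag_mx J *m u).
Proof.
by rewrite jdotE; apply: sumr_ge0 => i _; rewrite mulr_ge0// -expr2 sqr_ge0.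
Qed.

Lemma jdot_eq0 J (J_gt0 : forall i, 0 < J 0 i) u :
  dot u (diag_mx J *m u) = 0 -> u = 0.
Proof.
rewrite jdotE => /psumr_eq0P u0; apply/matrixP => i j; rewrite ord1 mxE.
have /eqP : J 0 i * (u i 0 * u i 0) = 0.
  by apply: u0 => // k _; rewrite mulr_ge0 ?(ltW (J_gt0 _))// -expr2 sqr_ge0.
by rewrite mulf_eq0 gt_eqF//= -expr2 sqrf_eq0 => /eqP.
Qed.

End Inertia.

(** * Algebra of the vector field *)

Section VectorField.
Context {R : realType} {n : nat} (J : 'rV[R]_n).
Hypothesis J_gt0 : forall i, 0 < J 0 i.
Implicit Types (q p u v w : 'cV[R]_n).

Let J_ge0 i : 0 <= J 0 i. Proof. exact: ltW. Qed.

Lemma shifted_inertia_gt0 q i : 0 < J 0 i + dot q (diag_mx J *m q).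
Proof. by rewrite ltr_pwDl// jdot_ge0. Qed.

Lemma Cmx_diag q :
  Cmx J q = diag_mx (\row_i (J 0 i + dot q (diag_mx J *m q))^-1).
Proof.
set D := diag_mx _; rewrite /Cmx; set K := _ + _%:M.
have KD : K *m D = 1%:M.
  rewrite /K -diag_const_mx -raddfD/= mulmx_diag -diag_const_mx.
  congr diag_mx; apply/rowP => i; rewrite !mxE divff// gt_eqF//.
  exact: shifted_inertia_gt0.
have [KU _] := mulmx1_unit KD.
by rewrite -[LHS]mulmx1 -KD mulKmx.
Qed.

Lemma mulCE q u i :
  (Cmx J q *m u) i 0 = u i 0 / (J 0 i + dot q (diag_mx J *m q)).
Proof. by rewrite Cmx_diag mul_diag_mx !mxE mulrC. Qed.

Lemma Cmx_sym q u v : dot u (Cmx J q *m v) = dot v (Cmx J q *m u).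
Proof. by rewrite dot_mulmxr Cmx_diag tr_diag_mx dotC. Qed.

Lemma Cmx_gt0 q u : u != 0 -> 0 < dot u (Cmx J q *m u).
Proof.
move=> u0; have C_gt0 i : 0 < (\row_i (J 0 i + dot q (diag_mx J *m q))^-1) 0 i.
  by rewrite mxE invr_gt0 shifted_inertia_gt0.
rewrite Cmx_diag lt_neqAle jdot_ge0 ?andbT => [|i]; last exact: ltW.
by apply: contra_neq u0 => /esym /(jdot_eq0 C_gt0).
Qed.

Definition multiplier q p : R :=
  dot p (Cmx J q *m q) / dot q (Cmx J q *m q).

Lemma veselova_qE q p :
  veselova_q J q p = Cmx J q *m (p - multiplier q p *: q).
Proof. by []. Qed.

(** The momentum is the image of the velocity under [J + (q . J q) Id] up to a
    multiple of [q], the constraint that keeps [q] on the sphere. *)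
Lemma momentum_velocity q p : q != 0 ->
  diag_mx J *m veselova_q J q p + dot q (diag_mx J *m q) *: veselova_q J q p
  = p - multiplier q p *: q.
Proof.
move=> q0; apply/matrixP => i j; rewrite ord1 [LHS]mxE mulJE [X in _ + X]mxE.
rewrite -mulrDl veselova_qE mulCE mulrC divfK// gt_eqF//.
exact: shifted_inertia_gt0.
Qed.

Lemma velocity_tangent q p : q != 0 -> dot q (veselova_q J q p) = 0.
Proof.
move=> q0; rewrite veselova_qE mulmxBr -scalemxAr !dot_linE Cmx_sym.
by rewrite divfK ?subrr// gt_eqF// Cmx_gt0.
Qed.

Lemma dot_momentum_velocity q p : q != 0 ->
  dot p (veselova_q J q p) = 2 * energy J q p.
Proof.
move=> q0; rewrite veselova_qE mulmxBr -scalemxAr !dot_linE.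
by rewrite /energy mulVKf// /multiplier expr2 mulrAC.
Qed.

Lemma dot_momentum_tangent q p w : q != 0 -> dot q w = 0 ->
  dot w (diag_mx J *m veselova_q J q p)
    + dot q (diag_mx J *m q) * dot w (veselova_q J q p) = dot w p.
Proof.
move=> q0 qw; rewrite -dotZr -dotDr momentum_velocity// !dot_linE (dotC w q) qw.
by rewrite mulr0 subr0.
Qed.

Lemma kinetic_energy q p : q != 0 ->
  dot (veselova_q J q p) (diag_mx J *m veselova_q J q p)
    + dot q (diag_mx J *m q) * dot (veselova_q J q p) (veselova_q J q p)
  = 2 * energy J q p.
Proof.
move=> q0; rewrite dot_momentum_tangent ?velocity_tangent//.
by rewrite dotC dot_momentum_velocity.
Qed.

(** Pairing the previous relation with [q] identifies the multiplier with minus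
    half the rate of change of [q . J q]; this is what makes the energy
    constant. *)
Lemma multiplierE q p : dot q q = 1 -> dot q p = 0 ->
  multiplier q p = - dot q (diag_mx J *m veselova_q J q p).
Proof.
move=> qq qp; have q0 : q != 0 by rewrite -dot_gt0 qq ltr01.
have := congr1 (dot q) (momentum_velocity p q0).
rewrite !dot_linE velocity_tangent// mulr0 addr0 qq qp => ->.
by rewrite mulr1 sub0r opprK.
Qed.

(** Legendre duality: twice the energy is the maximum of
    [2 p . w - w . (J + q . J q) w] over tangent vectors [w], attained at the
    velocity. Evaluating at the competitor [w = a *: p] leaves as a gap the
    quadratic form at the difference. *)
Lemma energy_gap q p a : q != 0 -> dot q p = 0 ->
  let z := veselova_q J q p - a *: p in
  dot z (diag_mx J *m z) + dot q (diag_mx J *m q) * dot z z =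
  2 * energy J q p - 2 * a * dot p p
    + a ^+ 2 * (dot p (diag_mx J *m p) + dot q (diag_mx J *m q) * dot p p).
Proof.
move=> q0 qp z.
have e1 := kinetic_energy p q0; have e2 := dot_momentum_tangent p q0 qp.
rewrite -e1 /z; move: e2; set v := veselova_q J q p => e2.
rewrite mulmxBr -scalemxAr !dot_linE (jdotC _ v p) (dotC v p).
have -> : dot p (diag_mx J *m v) = dot p p - dot q (diag_mx J *m q) * dot p v.
  by rewrite -e2 addrK.
ring.
Qed.

(** The gap for the competitor [m^-1 *: p] is nonnegative, which is the reverse
    of the assumed inequality. *)
Lemma inertia_eq_of_upper_bound q p m : 0 < m -> q != 0 -> p != 0 ->
  dot q p = 0 -> m * (2 * energy J q p) = dot p p ->
  dot p (diag_mx J *m p) + dot q (diag_mx J *m q) * dot p p <= m * dot p p ->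
  dot p (diag_mx J *m p) + dot q (diag_mx J *m q) * dot p p = m * dot p p.
Proof.
move=> m0 q0 p0 qp mH le; apply/eqP; rewrite eq_le le/=.
have := energy_gap m^-1 q0 qp; set X := _ + _ * dot p p => /= gapE.
have H : 2 * energy J q p = m^-1 * dot p p by rewrite -mH mulKf// gt_eqF.
have -> : (m * dot p p <= X) = (0 <= m ^+ 2 * (2 * energy J q p
    - 2 * m^-1 * dot p p + m^-1 ^+ 2 * X)).
  by rewrite -[LHS]subr_ge0 H; congr (0 <= _); field; rewrite gt_eqF.
by rewrite -gapE mulr_ge0 ?sqr_ge0// addr_ge0 ?mulr_ge0 ?jdot_ge0 ?dot_ge0.
Qed.

(** Here the bound is needed at the velocity instead of the momentum: it gives
    [|p - m v|^2 <= |p|^2 - m (2 H) = 0], so that the momentum is [m] times the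
    velocity. *)
Lemma inertia_eq_of_lower_bound q p m : 0 < m -> q != 0 ->
  m * (2 * energy J q p) = dot p p ->
  (let v := veselova_q J q p in
   m * dot v v <=
     dot v (diag_mx J *m v) + dot q (diag_mx J *m q) * dot v v) ->
  dot p (diag_mx J *m p) + dot q (diag_mx J *m q) * dot p p = m * dot p p.
Proof.
move=> m0 q0 mH /=; rewrite kinetic_energy// => le.
have pE : p = m *: veselova_q J q p.
  apply/eqP; rewrite -subr_eq0 -dot_eq0 eq_le dot_ge0 andbT.
  rewrite !dot_linE (dotC _ p) dot_momentum_velocity// -mH.
  have := ler_wpM2l (ltW m0) le; lra.
move: pE (kinetic_energy p q0) mH; clear.
move: (veselova_q J q p) (energy J q p) => v E pE vE mH.
rewrite -[in RHS]mH pE -scalemxAr !dot_linE -vE; ring.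
Qed.

(** The hypothesis holds when [q] and [p] span a [J]-invariant plane of moment
    of inertia [m]. The maximiser in the Legendre duality is unique, so that it
    can be read off from this relation. *)
Lemma velocity_principal q p m b : 0 < m -> q != 0 -> dot q p = 0 ->
  diag_mx J *m p + dot q (diag_mx J *m q) *: p = m *: p + b *: q ->
  veselova_q J q p = m^-1 *: p.
Proof.
move=> m0 q0 qp Kp; apply/eqP; rewrite -subr_eq0; apply/eqP.
apply: (jdot_eq0 J_gt0); apply/eqP; rewrite eq_le jdot_ge0// andbT.
have [z zE] : exists z, z = veselova_q J q p - m^-1 *: p by eexists.
rewrite -zE.
have qz : dot q z = 0 by rewrite zE !dot_linE velocity_tangent// qp mulr0 subrr.
have : dot z (diag_mx J *m z) + dot q (diag_mx J *m q) * dot z z = 0.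
  have e1 := dot_momentum_tangent p q0 qz.
  have := congr1 (dot z) Kp.
  rewrite !dotDr !dotZr (dotC z q) qz mulr0 addr0 => e2.
  have -> : dot z z = dot z (veselova_q J q p) - m^-1 * dot z p.
    by rewrite {2}zE dotBr dotZr.
  have -> : dot z (diag_mx J *m z) =
      dot z (diag_mx J *m veselova_q J q p) - m^-1 * dot z (diag_mx J *m p).
    by rewrite {2}zE mulmxBr -scalemxAr dotBr dotZr.
  have -> : dot z (diag_mx J *m p) =
    m * dot z p - dot q (diag_mx J *m q) * dot z p by rewrite -e2 addrK.
  have -> : dot z (diag_mx J *m veselova_q J q p) = dot z p -
    dot q (diag_mx J *m q) * dot z (veselova_q J q p) by rewrite -e1 addrK.
  by field; rewrite gt_eqF.
have := mulr_ge0 (jdot_ge0 J_ge0 q) (dot_ge0 z); lra.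
Qed.

End VectorField.

(** * The symmetry group *)

Section Symmetry.
Context {R : realType} {n : nat} (J : 'rV[R]_n).
Implicit Types (q p u v w f z : 'cV[R]_n) (h k : 'M[R]_n).

Lemma mulmx_cV_inj h k : (forall u, h *m u = k *m u) -> h = k.
Proof.
move=> hk; apply/matrixP => i j.
by have /matrixP /(_ i 0) := hk (delta_mx j 0); rewrite -!colE !mxE.
Qed.

Lemma GRP h : GR J h <-> h *m h^T = 1%:M /\ h *m diag_mx J = diag_mx J *m h.
Proof.
split=> -[hh hJ]; have [hU _] := mulmx1_unit hh; split=> //.
  by rewrite -[in RHS]hJ mulmxKV.
by rewrite hJ mulmxK.
Qed.

Lemma GR1 : GR J 1%:M.
Proof. by apply/GRP; rewrite trmx1 !mul1mx mulmx1. Qed.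

Lemma GRM h k : GR J h -> GR J k -> GR J (h *m k).
Proof.
move=> /GRP[hh hJ] /GRP[kk kJ]; apply/GRP; split.
  by rewrite trmx_mul mulmxA -(mulmxA h) kk mulmx1.
by rewrite -mulmxA kJ mulmxA hJ mulmxA.
Qed.

Lemma GR_dot h u v : GR J h -> dot (h *m u) (h *m v) = dot u v.
Proof. by move=> [/mulmx1C hh _]; rewrite dot_mulmxr mulmxA hh mul1mx. Qed.

Lemma GR_inertia h u : GR J h -> diag_mx J *m (h *m u) = h *m (diag_mx J *m u).
Proof. by move=> /GRP[_ hJ]; rewrite mulmxA -hJ -mulmxA. Qed.

Lemma GR_energy h q p : (forall i, 0 < J 0 i) -> GR J h ->
  energy J (h *m q) (h *m p) = energy J q p.
Proof.
move=> J_gt0 hG.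
have CE u : Cmx J (h *m q) *m (h *m u) = h *m (Cmx J q *m u).
  have -> : Cmx J (h *m q) = Cmx J q by rewrite /Cmx GR_inertia// GR_dot.
  have /GRP[_ hJ] := hG; set K := diag_mx J + (dot q (diag_mx J *m q))%:M.
  have hK : h *m K = K *m h by rewrite mulmxDr mulmxDl hJ scalar_mxC.
  have KU : K \in unitmx.
    rewrite unitmxE /K -diag_const_mx -raddfD/= det_diag unitfE.
    apply/prodf_neq0 => i _; rewrite !mxE gt_eqF//.
    exact: shifted_inertia_gt0.
  rewrite /Cmx -/K -[in LHS](mulKVmx KU u) (mulmxA h K) hK -(mulmxA K) mulKmx//.
by rewrite /energy !CE !GR_dot.
Qed.

Lemma GR_phase_space h x : GR J h -> phase_space R n x ->
  phase_space R n (act h x).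
Proof.
by move=> hG [/enorm1 x1 x12]; split=> /=; [apply/enorm1|]; rewrite GR_dot.
Qed.

(** The Householder reflection in the hyperplane orthogonal to [f - g] commutes
    with the inertia tensor as [f - g] is an eigenvector. *)
Lemma eigenspace_reflection l f g :
  diag_mx J *m f = l *: f -> diag_mx J *m g = l *: g -> dot f f = dot g g ->
  exists h, [/\ GR J h, h *m f = g &
    forall z, dot f z = dot g z -> h *m z = z].
Proof.
move=> Jf Jg fg; have [->|fNg] := eqVneq f g.
  by exists 1%:M; split=> [||z _]; [exact: GR1|exact: mul1mx|exact: mul1mx].
have [w wE] : exists w, w = f - g by eexists.
have w0 : dot w w != 0 by rewrite dot_eq0 wE subr_eq0.
have Jw : diag_mx J *m w = l *: w by rewrite wE mulmxBr Jf Jg scalerBr.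
pose h : 'M[R]_n := 1%:M - (2 / dot w w) *: (w *m w^T).
have hE z : h *m z = z - (2 / dot w w * dot w z) *: w.
  rewrite mulmxBl mul1mx -scalemxAl -mulmxA [w^T *m z]mx11_scalar mul_mx_scalar.
  by rewrite scalerA -dotE.
have hT : h^T = h.
  by rewrite /h linearB/= linearZ/= trmx_mul trmxK trmx1.
have Jh z : h *m (diag_mx J *m z) = diag_mx J *m (h *m z).
  rewrite !hE mulmxBr -scalemxAr Jw dot_mulmxr tr_diag_mx Jw dotZl !scalerA.
  by congr (_ - _ *: _); ring.
exists h; split.
- apply/GRP; rewrite hT; split; apply: mulmx_cV_inj => z; last first.
    by rewrite -!mulmxA Jh.
  rewrite -mulmxA mul1mx [X in h *m X]hE hE dotBr dotZr.
  rewrite -addrA -opprD -scalerDl.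
  have -> : 2 / dot w w * dot w z + 2 / dot w w *
      (dot w z - 2 / dot w w * dot w z * dot w w) = 0 by field.
  by rewrite scale0r subr0.
- rewrite hE; have -> : 2 / dot w w * dot w f = 1.
    apply: (mulIf w0); rewrite mulrAC divfK// mul1r wE.
    by rewrite !dot_linE (dotC g f) fg; ring.
  by rewrite scale1r wE subKr.
- by move=> z fz; rewrite hE wE [dot _ z]dotBl fz subrr mulr0 scale0r subr0.
Qed.

End Symmetry.

(** * Pairs of extremal moment of inertia *)

Section ExtremalPairs.
Context {R : realType} {n : nat} (J : 'rV[R]_n).
Implicit Types (u v w x y : 'cV[R]_n) (a b i : 'I_n).

Definition orthonormal_pair u w := [/\ dot u u = 1, dot w w = 1 & dot u w = 0].

Definition pair_inertia u w :=
  dot u (diag_mx J *m u) + dot w (diag_mx J *m w).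

Definition two_largest a b :=
  [/\ a != b, J 0 b <= J 0 a & forall i, i != a -> J 0 i <= J 0 b].

Lemma exists_two_largest : (2 <= n)%N -> exists a b, two_largest a b.
Proof.
move=> n2; pose i0 : 'I_n := Ordinal (ltnW n2).
have [a _ aP] : exists2 a, true & forall i, J 0 i <= J 0 a.
  by case: (@arg_maxP _ _ _ i0 xpredT (fun i => J 0 i)) => // a _ aP;
    exists a => // i; exact: aP.
have [b0 b0P] : exists b0, b0 != a.
  have [->|aN] := eqVneq a i0; last by exists i0; rewrite eq_sym.
  by exists (Ordinal n2).
case: (@arg_maxP _ _ _ b0 (fun i => i != a) (fun i => J 0 i)) => // b bN bP.
by exists a, b; split=> //; rewrite eq_sym.
Qed.

(** The weights [u_i ^ 2 + w_i ^ 2] have sum 2 and none exceeds 1, so the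
    weighted sum of the [J_i] falls short of [J_a + J_b] by a sum of
    nonnegative terms. *)
Lemma pair_inertia_defect a b u w : orthonormal_pair u w ->
  J 0 a + J 0 b - pair_inertia u w =
  (J 0 a - J 0 b) * (1 - (u a 0 ^+ 2 + w a 0 ^+ 2))
  + \sum_(i | i != a) (J 0 b - J 0 i) * (u i 0 ^+ 2 + w i 0 ^+ 2).
Proof.
move=> [uu ww uw].
have sum2 : \sum_i (u i 0 ^+ 2 + w i 0 ^+ 2) = 2.
  by rewrite big_split/=; under eq_bigr do rewrite expr2;
    under [X in _ + X]eq_bigr do rewrite expr2; rewrite -[2]/(1 + 1) -{1}uu -ww.
have -> : pair_inertia u w = \sum_i J 0 i * (u i 0 ^+ 2 + w i 0 ^+ 2).
  rewrite /pair_inertia !jdotE -big_split/=; apply: eq_bigr => i _.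
  by rewrite !expr2 mulrDr.
transitivity (J 0 a - J 0 b
    + \sum_i (J 0 b - J 0 i) * (u i 0 ^+ 2 + w i 0 ^+ 2)).
  under [in RHS]eq_bigr do rewrite mulrBl.
  by rewrite sumrB -mulr_sumr sum2; ring.
rewrite [in LHS](bigD1 a)//=; ring.
Qed.

Lemma defect_ge0 a b u w : two_largest a b -> orthonormal_pair u w ->
  0 <= (J 0 a - J 0 b) * (1 - (u a 0 ^+ 2 + w a 0 ^+ 2)) /\
  (forall i, i != a -> 0 <= (J 0 b - J 0 i) * (u i 0 ^+ 2 + w i 0 ^+ 2)).
Proof.
move=> [_ ba bP] [uu ww uw]; split=> [|i ia].
  by rewrite mulr_ge0// subr_ge0// bessel_coord.
by rewrite mulr_ge0 ?subr_ge0 ?bP// addr_ge0 ?sqr_ge0.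
Qed.

Lemma pair_inertia_le a b u w : two_largest a b -> orthonormal_pair u w ->
  pair_inertia u w <= J 0 a + J 0 b.
Proof.
move=> ab uw; rewrite -subr_ge0 (pair_inertia_defect a b uw).
by have [d0 di] := defect_ge0 ab uw; rewrite addr_ge0// sumr_ge0.
Qed.

Lemma pair_inertia_eq a b u w : two_largest a b -> orthonormal_pair u w ->
  pair_inertia u w = J 0 a + J 0 b ->
  (J 0 a != J 0 b -> u a 0 ^+ 2 + w a 0 ^+ 2 = 1) /\
  (forall i, i != a -> J 0 i != J 0 b -> u i 0 = 0 /\ w i 0 = 0).
Proof.
move=> ab uw eq; have := pair_inertia_defect a b uw.
have [d0 di] := defect_ge0 ab uw.
rewrite eq subrr => /esym/eqP; rewrite paddr_eq0 ?sumr_ge0// => /andP[].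
rewrite mulf_eq0 subr_eq0 => dE /eqP/psumr_eq0P sE; split=> [aNb|i ia iNb].
  by move: dE; rewrite (negbTE aNb)/= subr_eq0 => /eqP.
have /eqP := sE di i ia; rewrite mulf_eq0 subr_eq0 eq_sym (negbTE iNb)/=.
by rewrite paddr_eq0 ?sqr_ge0// !sqrf_eq0 => /andP[/eqP -> /eqP ->].
Qed.

(** Equality in the bound with [J_a != J_b] forces weight 1 on [a], so that
    [e_a] lies in the span of [u], [w]; the remaining unit vector [f] of that
    span lies in the eigenspace of [J_b]. *)
Lemma extremal_pair_frame a b u w : two_largest a b -> orthonormal_pair u w ->
  pair_inertia u w = J 0 a + J 0 b -> J 0 a != J 0 b ->
  let f := u a 0 *: w - w a 0 *: u in
  [/\ u = u a 0 *: delta_mx a 0 - w a 0 *: f,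
      w = w a 0 *: delta_mx a 0 + u a 0 *: f,
      dot f f = 1, dot f (delta_mx a 0) = 0
    & diag_mx J *m f = J 0 b *: f].
Proof.
move=> ab uw eq aNb f; have [ga gi] := pair_inertia_eq ab uw eq.
have {}ga := ga aNb; have [uu ww uw0] := uw.
have eE : delta_mx a 0 = u a 0 *: u + w a 0 *: w.
  apply/eqP; rewrite -subr_eq0 -dot_eq0; apply/eqP.
  rewrite !dot_linE !(dotC _ (delta_mx a 0)) !dot_delta (dotC w u) uu ww uw0.
  by rewrite mxE !eqxx/=; move: ga; lra.
have fa : f a 0 = 0 by rewrite !mxE mulrC subrr.
split.
- rewrite eE /f; apply/matrixP => i j; rewrite !mxE.
  by rewrite -[LHS]mul1r -ga; ring.
- rewrite eE /f; apply/matrixP => i j; rewrite !mxE.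
  by rewrite -[LHS]mul1r -ga; ring.
- rewrite /f !dot_linE (dotC w u) uu ww uw0; move: ga; lra.
- by rewrite dotC dot_delta.
- apply/matrixP => i j; rewrite ord1 mulJE [RHS]mxE.
  have [->|ia] := eqVneq i a; first by rewrite fa !mulr0.
  have [->//|ib] := eqVneq (J 0 i) (J 0 b).
  by have [ui wi] := gi i ia ib; rewrite !mxE ui wi !mulr0 subr0 !mulr0.
Qed.

Lemma extremal_pair_eigen a b u w : two_largest a b -> orthonormal_pair u w ->
  pair_inertia u w = J 0 a + J 0 b -> J 0 a = J 0 b ->
  diag_mx J *m u = J 0 b *: u /\ diag_mx J *m w = J 0 b *: w.
Proof.
move=> ab uw eq aEb; have [_ gi] := pair_inertia_eq ab uw eq.
split; apply/matrixP => i j; rewrite ord1 mulJE [RHS]mxE;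
  have [->|ia] := eqVneq i a; rewrite ?aEb//;
  have [->//|ib] := eqVneq (J 0 i) (J 0 b);
  by have [ui wi] := gi i ia ib; rewrite ?ui ?wi !mulr0.
Qed.

(** If the two largest eigenvalues agree, both pairs lie in one eigenspace and
    two reflections match them vector by vector. Otherwise equal components
    along [e_a] leave only the eigenvectors [f] of the two frames to be matched,
    by one reflection that fixes [e_a]. *)
Lemma extremal_pairs_conjugate a b u w x y : two_largest a b ->
  orthonormal_pair u w -> pair_inertia u w = J 0 a + J 0 b ->
  orthonormal_pair x y -> pair_inertia x y = J 0 a + J 0 b ->
  (J 0 a != J 0 b -> u a 0 = x a 0 /\ w a 0 = y a 0) ->
  exists h, [/\ GR J h, h *m u = x & h *m w = y].
Proof.
move=> ab uw uwE xy xyE same; have [aEb|aNb] := eqVneq (J 0 a) (J 0 b).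
  have [Ju Jw] := extremal_pair_eigen ab uw uwE aEb.
  have [Jx Jy] := extremal_pair_eigen ab xy xyE aEb.
  have [uu ww uw0] := uw; have [xx yy xy0] := xy.
  have [h1 [h1G h1u _]] : exists h, [/\ GR J h, h *m u = x &
      forall z, dot u z = dot x z -> h *m z = z].
    apply: (eigenspace_reflection Ju Jx); by rewrite uu.
  have [h2 [h2G h2w h2fix]] : exists h, [/\ GR J h, h *m (h1 *m w) = y &
      forall z, dot (h1 *m w) z = dot y z -> h *m z = z].
    apply: (@eigenspace_reflection _ _ _ (J 0 b)) => //.
      by rewrite GR_inertia// Jw scalemxAr.
    by rewrite (GR_dot _ _ h1G) ww.
  exists (h2 *m h1); rewrite -!mulmxA h1u h2w h2fix.
    by split=> //; exact: GRM.
  by rewrite -h1u (GR_dot _ _ h1G) dotC uw0 h1u dotC xy0.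
have [] := extremal_pair_frame ab uw uwE aNb.
have [] := extremal_pair_frame ab xy xyE aNb.
have [-> ->] := same aNb; set g := _ *: y - _ => xE yE gg ge Jg.
set f := _ *: w - _ => uE wE ff fe Jf.
have [h [hG hf hfix]] : exists h, [/\ GR J h, h *m f = g &
    forall z, dot f z = dot g z -> h *m z = z].
  by apply: (eigenspace_reflection Jf Jg); rewrite ff.
exists h; split=> //.
- by rewrite uE mulmxBr -!scalemxAr hf hfix ?fe// -xE.
- by rewrite wE mulmxDr -!scalemxAr hf hfix ?fe// -yE.
Qed.

End ExtremalPairs.

(** * The moment of inertia of a principal plane *)

Section PlaneInertia.
Context {R : realType}.

Lemma char_poly2 (A : 'M[R]_2) : char_poly A = 'X^2 - \tr A *: 'X + (\det A)%:P.
Proof.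
have cs : size (char_poly A) = 3 by rewrite size_char_poly.
apply/polyP => -[|[|[|i]]];
  rewrite !(coefD, coefN, coefZ, coefX, coefXn, coefC) /=
    ?mulr0 ?mulr1 ?subr0 ?sub0r ?addr0
  ?add0r.
- by rewrite char_poly_det sqrrN expr1n mul1r.
- exact: (@char_poly_trace _ _ A).
- by have /monicP := char_poly_monic A; rewrite lead_coefE cs.
- by rewrite nth_default// cs.
Qed.

Lemma poly2_roots (a b : R) :
  ('X - a%:P) * ('X - b%:P) = 'X^2 - (a + b) *: 'X + (a * b)%:P.
Proof. by rewrite polyCM -mul_polyC polyCD; ring. Qed.

Lemma det2 (A : 'M[R]_2) : \det A = A 0 0 * A 1 1 - A 0 1 * A 1 0.
Proof.
rewrite (expand_det_row _ 0) !big_ord_recl big_ord0 addr0 /cofactor !det_mx11.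
rewrite !mxE/= expr0 expr1 mul1r mulN1r mulrN.
by congr (A _ _ * A _ _ - A _ _ * A _ _); apply/val_inj.
Qed.

Lemma trace2 (A : 'M[R]_2) : \tr A = A 0 0 + A 1 1.
Proof.
rewrite /mxtrace !big_ord_recl big_ord0 addr0.
by congr (_ + A _ _); apply/val_inj.
Qed.

(** Restricting to an invariant plane gives a matrix similar to the compression
    to any orthonormal basis [U] of that plane. *)
Lemma char_poly_restriction n r (f : 'M[R]_n) (B : 'M[R]_(r, n))
    (U : 'M[R]_(2, n)) : r = 2%N -> stablemx B f -> (U <= B)%MS ->
  U *m U^T = 1%:M ->
  char_poly (conjmx B f) =
    'X^2 - \tr (U *m f *m U^T) *: 'X + (\det (U *m f *m U^T))%:P.
Proof.
move=> r2; subst r => Bf /submxP[P UE] UU.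
set N := conjmx B f; have NB : N *m B = B *m f by rewrite /N /conjmx mulmxKpV.
set Q := B *m U^T; have PQ : P *m Q = 1%:M by rewrite mulmxA -UE.
have QP := mulmx1C PQ.
have -> : U *m f *m U^T = P *m N *m Q.
  by rewrite /Q UE -(mulmxA P B f) -NB !mulmxA.
rewrite char_poly2 (mxtrace_mulC (P *m N)) (mulmxA Q) QP mul1mx.
rewrite !det_mulmx mulrAC -det_mulmx.
by rewrite PQ det1 mul1r.
Qed.

Lemma plane_inertia_pair n (J : 'rV[R]_n) (Pi : 'M[R]_n) (u w : 'cV[R]_n) :
  principal_plane J Pi -> orthonormal_pair u w ->
  (u^T <= Pi)%MS -> (w^T <= Pi)%MS ->
  plane_inertia J Pi = pair_inertia J u w.
Proof.
move=> [rk st] [uu ww uw] uPi wPi.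
pose U : 'M[R]_(2, n) := \matrix_(i, k) (if i == 0 then u k 0 else w k 0).
have rowU i : row i U = if i == 0 then u^T else w^T.
  by apply/rowP => k; rewrite !mxE; case: ifP => _; rewrite !mxE.
have entry g i j : (U *m g *m U^T) i j =
    dot (row i U)^T (g *m (row j U)^T).
  by rewrite dotE trmxK mulmxA -row_mul !mxE; apply: eq_bigr => k _;
    rewrite !mxE.
have UU : U *m U^T = 1%:M.
  apply/matrixP => i j; have := entry 1%:M i j; rewrite mulmx1 => ->.
  rewrite mul1mx !rowU mxE.
  by case: i j => [[|[|//]] ?] [[|[|//]] ?] /=; rewrite !trmxK// dotC.
have chiE :=
  char_poly_restriction (B := row_base Pi) (U := U) (f := diag_mx J) rk.
rewrite stablemx_row_base eq_row_base in chiE.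
have {}chiE := chiE st _ UU.
have trE : \tr (U *m diag_mx J *m U^T) = pair_inertia J u w.
  by rewrite trace2 !entry !rowU /= !trmxK.
have /chiE {}chiE : (U <= Pi)%MS.
  by apply/row_subP => i; rewrite rowU; case: ifP.
rewrite /plane_inertia; case: xgetP => [m _ [a [b [ab ->]]]|none].
  have := congr1 (fun P : {poly R} => P`_1) ab; rewrite chiE trE.
  rewrite poly2_roots !(coefD, coefN, coefZ, coefX, coefXn, coefC)/=.
  by rewrite !mulr1 !sub0r !addr0 => /oppr_inj.
(* In an orthonormal basis the restriction is the symmetric matrix with
   diagonal entries [A], [C] and off-diagonal entry [B], whose discriminant is a
   sum of squares. *)
exfalso.
pose A := dot u (diag_mx J *m u); pose B := dot u (diag_mx J *m w).
pose C := dot w (diag_mx J *m w).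
pose d := Num.sqrt ((A - C) ^+ 2 + 4 * B ^+ 2).
apply: (none (A + C)); exists ((A + C + d) / 2), ((A + C - d) / 2).
split; last by field.
rewrite chiE trE det2 !entry !rowU /= !trmxK (jdotC _ w u) /pair_inertia.
rewrite -/A -/B -/C.
rewrite poly2_roots; congr (_ - _ *: _ + _%:P); first by field.
have dd : d ^+ 2 = (A - C) ^+ 2 + 4 * B ^+ 2.
  by rewrite sqr_sqrtr// addr_ge0 ?sqr_ge0// mulr_ge0 ?sqr_ge0.
transitivity (((A + C) ^+ 2 - d ^+ 2) / 4); first by rewrite dd; field.
by field.
Qed.

Lemma orthonormal_row_free n (u w : 'cV[R]_n) :
  orthonormal_pair u w -> row_free (col_mx u^T w^T).
Proof.
move=> [uu ww uw]; apply/row_freeP; exists (col_mx u^T w^T)^T.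
have dotM (x y : 'cV[R]_n) : x^T *m y = (dot x y)%:M.
  by rewrite [LHS]mx11_scalar -dotE.
rewrite tr_col_mx !trmxK mul_col_row !dotM uu ww (dotC w) uw raddf0.
by rewrite -scalar_mx_block.
Qed.

Lemma plane_expansion n (Pi : 'M[R]_n) (u w x : 'cV[R]_n) : \rank Pi = 2%N ->
  orthonormal_pair u w -> (u^T <= Pi)%MS -> (w^T <= Pi)%MS ->
  (x^T <= Pi)%MS -> x = dot u x *: u + dot w x *: w.
Proof.
move=> rk uw uPi wPi xPi; have UPi : (col_mx u^T w^T <= Pi)%MS.
  by rewrite -addsmxE addsmx_sub uPi.
have PiU : (Pi <= col_mx u^T w^T)%MS.
  by rewrite -(geq_leqif (mxrank_leqif_sup UPi)) rk
    (eqP (orthonormal_row_free uw)).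
have := submx_trans xPi PiU; rewrite -addsmxE => /sub_addsmxP[[a b]] /= xE.
have {xE} : x = a 0 0 *: u + b 0 0 *: w.
  apply: trmx_inj; rewrite xE linearD/= !linearZ/=.
  by rewrite [a]mx11_scalar [b]mx11_scalar !mul_scalar_mx !mxE !mulr1n.
have [uu ww uw0] := uw => xE; rewrite {2 3}xE !dot_linE (dotC w u) uu ww uw0.
by rewrite !mulr0 !mulr1 addr0 add0r.
Qed.

(** Comparison with these planes turns the extremality of a plane among all
    invariant ones into bounds on sums of two diagonal entries. *)
Lemma coordinate_plane n (J : 'rV[R]_n) (i j : 'I_n) : i != j ->
  exists2 Pi : 'M[R]_n, principal_plane J Pi &
    plane_inertia J Pi = J 0 i + J 0 j.
Proof.
move=> ij; set e : 'I_n -> 'cV[R]_n := fun k => delta_mx k 0.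
have Je k : diag_mx J *m e k = J 0 k *: e k.
  apply/matrixP => l z; rewrite ord1 mulJE !mxE.
  by have [->//|_] := eqVneq l k; rewrite !mulr0.
have ee k l : dot (e k) (e l) = (k == l)%:R by rewrite dot_delta mxE andbT.
pose U := col_mx (e i)^T (e j)^T; pose Pi := <<U>>%MS.
have PiE : (Pi :=: (e i)^T + (e j)^T)%MS.
  exact: eqmx_trans (genmxE _) (eqmx_sym (addsmxE _ _)).
have oij : orthonormal_pair (e i) (e j).
  by split; rewrite ee ?eqxx// (negbTE ij).
have PiP : principal_plane J Pi.
  split.
    rewrite genmxE; apply/eqP; rewrite -[_ == _]/(row_free U).
    exact: orthonormal_row_free.
  rewrite (eqmx_stable _ (genmxE _)) mul_col_mx -!addsmxE.
  have eJ k : (e k)^T *m diag_mx J = J 0 k *: (e k)^T.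
    by apply: trmx_inj; rewrite trmx_mul tr_diag_mx trmxK Je linearZ/= trmxK.
  by rewrite !eJ addsmxS// scalemx_sub.
exists Pi => //.
rewrite (plane_inertia_pair PiP oij) ?PiE ?addsmxSl ?addsmxSr//.
by rewrite /pair_inertia !Je !dotZr !ee !eqxx !mulr1.
Qed.

End PlaneInertia.

(** * Conserved quantities *)

Section PointwiseDerivation.
Context {R : realType}.
Implicit Types (f g : R -> R) (t a b : R).

Lemma is_derive_cong f t a b : is_derive t 1 f a -> a = b -> is_derive t 1 f b.
Proof. by move=> + <-. Qed.

Lemma is_derive_add f g t a b : is_derive t 1 f a -> is_derive t 1 g b ->
  is_derive t 1 (fun s => f s + g s) (a + b).
Proof. by move=> fa gb; exact: is_deriveD. Qed.

Lemma is_derive_sub f g t a b : is_derive t 1 f a -> is_derive t 1 g b ->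
  is_derive t 1 (fun s => f s - g s) (a - b).
Proof. by move=> fa gb; exact: is_deriveB. Qed.

Lemma is_derive_mul f g t a b : is_derive t 1 f a -> is_derive t 1 g b ->
  is_derive t 1 (fun s => f s * g s) (a * g t + f t * b).
Proof.
move=> fa gb; rewrite [X in is_derive _ _ _ X](_ : _ = f t *: b + g t *: a).
  exact: is_deriveM.
by rewrite addrC (mulrC a).
Qed.

Lemma is_derive_inv f t a : f t != 0 -> is_derive t 1 f a ->
  is_derive t 1 (fun s => (f s)^-1) (- (a / f t ^+ 2)).
Proof.
move=> ft0 fa; have := is_deriveV ft0 fa.
by rewrite scaleNr /GRing.scale/= mulrC.
Qed.

Lemma is_derive_fsum n (F : 'I_n -> R -> R) (dF : 'I_n -> R) t :
  (forall i, is_derive t 1 (F i) (dF i)) ->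
  is_derive t 1 (fun s => \sum_i F i s) (\sum_i dF i).
Proof.
move=> dFi; rewrite [X in is_derive _ _ X](_ : _ = \sum_i F i).
  exact: is_derive_sum.
by apply/funext => s; rewrite fct_sumE.
Qed.

Lemma is_derive_coord n (c : R -> 'cV[R]_n) t (d : 'cV[R]_n) (i : 'I_n) :
  is_derive t 1 c d -> is_derive t 1 (fun s => c s i 0) (d i 0).
Proof.
move=> [cd cE]; apply: DeriveDef; first by have /derivable_mxP := cd.
have /matrixP /(_ i 0) := derive_mx cd; rewrite cE mxE. done.
Qed.

Lemma is_derive_dot n (c e : R -> 'cV[R]_n) t (dc de : 'cV[R]_n) :
  is_derive t 1 c dc -> is_derive t 1 e de ->
  is_derive t 1 (fun s => dot (c s) (e s)) (dot dc (e t) + dot (c t) de).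
Proof.
move=> dcE deE; rewrite -big_split/=; apply: is_derive_fsum => i.
by apply: is_derive_mul; exact: is_derive_coord.
Qed.

Lemma constant_on_interval (I : set R) f : is_interval I ->
  (forall t, I t -> is_derive t 1 f 0) -> forall s t, I s -> I t -> f s = f t.
Proof.
move=> itvI df s t; wlog st : s t / s <= t => [hw Is It|Is It].
  by have /orP[st|ts] := le_total s t; [exact: hw|rewrite (hw t s)].
have sub x : x \in `[s, t] -> I x.
  by rewrite in_itv/= => /andP[sx xt]; apply: (itvI _ _ Is It); rewrite sx xt.
have [x xI|x xst|c _] := @MVT_segment _ f (fun=> 0) s t st.
- by apply/df/sub; exact: subset_itv_oo_cc xI.
- have : {in `[s, t], forall x, derivable f x 1}.
    by move=> y /sub /df [].
  by move=> /derivable_within_continuous; apply.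
- by rewrite mul0r => /eqP; rewrite subr_eq0 => /eqP.
Qed.

End PointwiseDerivation.

Section Conservation.
Context {R : realType} {n : nat} (J : 'rV[R]_n).
Hypothesis J_gt0 : forall i, 0 < J 0 i.

(** Minimising over the multiplier turns the energy into a sum of squares, the
    form in which the multiplier does not contribute to its derivative. *)
Lemma energy_sumE (q p : 'cV[R]_n) :
  2 * energy J q p = \sum_i (p i 0 - multiplier J q p * q i 0) ^+ 2
    * (J 0 i + dot q (diag_mx J *m q))^-1.
Proof.
transitivity (dot (p - multiplier J q p *: q)
   (Cmx J q *m (p - multiplier J q p *: q))); last first.
  by apply: eq_bigr => i _; rewrite mulCE// mulrA !mxE expr2.
rewrite /energy mulVKf// mulmxBr -scalemxAr !dot_linE (Cmx_sym J_gt0 q q p).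
rewrite /multiplier; have [->|q0] := eqVneq q 0.
  by rewrite mulmx0 !dot0r expr0n !(mul0r, mulr0, subr0, oppr0, addr0).
by field; rewrite gt_eqF// Cmx_gt0.
Qed.

Variables (q p : R -> 'cV[R]_n) (t : R).
Hypothesis q_unit : dot (q t) (q t) = 1.
Hypothesis qp0 : dot (q t) (p t) = 0.
Hypothesis dq : is_derive t 1 q (veselova_q J (q t) (p t)).
Hypothesis dp : is_derive t 1 p (veselova_p J (q t) (p t)).

Lemma is_derive_momentum_norm : is_derive t 1 (fun s => dot (p s) (p s)) 0.
Proof.
rewrite [X in is_derive _ _ _ X](_ : _ =
    dot (veselova_p J (q t) (p t)) (p t) + dot (p t) (veselova_p J (q t) (p t))).
  exact: is_derive_dot.
by rewrite /veselova_p !dot_linE (dotC (p t)) qp0 mulr0 addr0.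
Qed.

(** Differentiating the sum of squares gives
    [- (2 mu + (q . J q)') |v|^2], because [q . v = 0] removes the terms with
    the derivative of the multiplier [mu] and with the derivative of [p]; the
    bracket vanishes as [mu = - q . J v]. *)
Lemma is_derive_energy :
  is_derive t 1 (fun s => 2 * energy J (q s) (p s)) 0.
Proof.
have q0 : q t != 0 by rewrite -dot_gt0 q_unit ltr01.
pose v := veselova_q J (q t) (p t); have dqv : is_derive t 1 q v := dq.
set mu := multiplier J (q t) (p t).
have qv : dot (q t) v = 0 by exact: velocity_tangent.
have muE : mu = - dot (q t) (diag_mx J *m v) by exact: multiplierE.
have K0 i : J 0 i + dot (q t) (diag_mx J *m q t) != 0.
  by rewrite gt_eqF// shifted_inertia_gt0.
have dqi i := is_derive_coord i dqv; have dpi i := is_derive_coord i dp.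
have ds : is_derive t 1 (fun s => dot (q s) (diag_mx J *m q s)) (- 2 * mu).
  rewrite (_ : (fun s => _) = fun s => \sum_i J 0 i * (q s i 0 * q s i 0));
    last by apply/funext => s; rewrite jdotE.
  have dF := is_derive_fsum (fun i => is_derive_mul (is_derive_cst (J 0 i) t 1)
    (is_derive_mul (dqi i) (dqi i))).
  apply: is_derive_cong dF _.
  rewrite muE jdotE mulrNN mulr_sumr; apply: eq_bigr => i _; rewrite /cst; ring.
have dKV i : is_derive t 1 (fun s => (J 0 i + dot (q s) (diag_mx J *m q s))^-1)
    (- ((- 2 * mu) / (J 0 i + dot (q t) (diag_mx J *m q t)) ^+ 2)).
  have dK := is_derive_add (is_derive_cst (J 0 i) t 1) ds.
  apply: is_derive_cong (is_derive_inv (K0 i : (fun s => J 0 i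
    + dot (q s) (diag_mx J *m q s)) t != 0) dK) _.
  by rewrite add0r.
have dC (c e : R -> 'cV[R]_n) dc de : is_derive t 1 c dc -> is_derive t 1 e de ->
    derivable (fun s => dot (c s) (Cmx J (q s) *m e s)) t 1.
  move=> dcE deE.
  rewrite (_ : (fun s => _) = fun s => \sum_i c s i 0 * (e s i 0 *
     (J 0 i + dot (q s) (diag_mx J *m q s))^-1)); last first.
    by apply/funext => s; apply: eq_bigr => i _; rewrite mulCE.
  by have [] := is_derive_fsum (fun i => is_derive_mul (is_derive_coord i dcE)
    (is_derive_mul (is_derive_coord i deE) (dKV i))).
have [m' dmu] : exists m', is_derive t 1 (fun s => multiplier J (q s) (p s)) m'.
  have dA := derivableP (dC _ _ _ _ dqv dqv).
  have A0 : (fun s => dot (q s) (Cmx J (q s) *m q s)) t != 0.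
    by rewrite gt_eqF// Cmx_gt0.
  by eexists; exact: (is_derive_mul (derivableP (dC _ _ _ _ dp dqv))
    (is_derive_inv A0 dA)).
rewrite (_ : (fun s => 2 * _) = fun s => \sum_i
    ((p s i 0 - multiplier J (q s) (p s) * q s i 0) *
     (p s i 0 - multiplier J (q s) (p s) * q s i 0)
    * (J 0 i + dot (q s) (diag_mx J *m q s))^-1)); last first.
  by apply/funext => s; rewrite energy_sumE.
have dw i := is_derive_sub (dpi i) (is_derive_mul dmu (dqi i)).
have dE := is_derive_fsum (fun i => is_derive_mul
  (is_derive_mul (dw i) (dw i)) (dKV i)).
apply: is_derive_cong dE _; apply/esym.
have vi i : p t i 0 - mu * q t i 0 =
    v i 0 * (J 0 i + dot (q t) (diag_mx J *m q t)).
  by rewrite /v veselova_qE mulCE// divfK// !mxE.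
rewrite -/mu; under eq_bigr => i _ do rewrite vi.
pose h := - (2 * energy J (q t) (p t)).
have vpE i : veselova_p J (q t) (p t) i 0 = h * q t i 0 by rewrite mxE.
transitivity (2 * (h - m') * dot (q t) v - 2 * mu * dot v v + 2 * mu * dot v v).
  by rewrite qv mulr0 sub0r addNr.
rewrite /dot !mulr_sumr -sumrB -big_split/=; apply: eq_bigr => i _.
by rewrite vpE; field; exact: K0.
Qed.

End Conservation.

(** * Stability from a conserved function *)

Section Topology.
Context {R : realType} {n : nat}.
Local Notation state := ('cV[R]_n * 'cV[R]_n)%type.

Section Limits.
Context {T : Type} (F : set_system T) {FF : Filter F}.

Lemma cvg_fsum k (f : 'I_k -> T -> R) (l : 'I_k -> R) :
  (forall i, f i x @[x --> F] --> l i) ->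
  \sum_i f i x @[x --> F] --> \sum_i l i.
Proof. by move=> fl; apply: (cvg_big add_continuous) => i _; exact: fl. Qed.

Lemma cvg_coord (f : T -> 'cV[R]_n) (l : 'cV[R]_n) i :
  f x @[x --> F] --> l -> f x i 0 @[x --> F] --> l i 0.
Proof.
move=> fl; apply: (cvg_comp f (fun M : 'cV[R]_n => M i 0) fl).
exact: coord_continuous.
Qed.

Lemma cvg_dot (f g : T -> 'cV[R]_n) (l m : 'cV[R]_n) :
  f x @[x --> F] --> l -> g x @[x --> F] --> m ->
  dot (f x) (g x) @[x --> F] --> dot l m.
Proof. by move=> fl gm; apply: cvg_fsum => i; apply: cvgM; exact: cvg_coord. Qed.

End Limits.

Lemma continuous_fst_state : continuous (fun x : state => x.1).
Proof. by move=> x; exact: cvg_fst. Qed.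

Lemma continuous_snd_state : continuous (fun x : state => x.2).
Proof. by move=> x; exact: cvg_snd. Qed.

Lemma continuous_energy (J : 'rV[R]_n) (x : state) :
  (forall i, 0 < J 0 i) -> x.1 != 0 ->
  energy J y.1 y.2 @[y --> x] --> energy J x.1 x.2.
Proof.
move=> J_gt0 x0; have c1 := @continuous_fst_state x.
have c2 := @continuous_snd_state x.
have cC (f g : state -> 'cV[R]_n) : f y @[y --> x] --> f x ->
    g y @[y --> x] --> g x ->
    dot (f y) (Cmx J y.1 *m g y) @[y --> x] --> dot (f x) (Cmx J x.1 *m g x).
  move=> cf cg; apply: cvg_fsum => i; apply: cvgM; first exact: cvg_coord.
  rewrite mulCE//; under eq_fun do rewrite mulCE//.
  apply: cvgM; first exact: cvg_coord.
  apply: cvgV; first by rewrite gt_eqF// shifted_inertia_gt0.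
  apply: cvgD; first exact: cvg_cst.
  rewrite jdotE; under eq_fun do rewrite jdotE.
  apply: cvg_fsum => k; apply: cvgM; first exact: cvg_cst.
  by apply: cvgM; exact: cvg_coord.
apply: cvgM; first exact: cvg_cst.
apply: cvgB; first exact: cC.
apply: cvgM; first by apply: cvgM; exact: cC.
by apply: cvgV; [rewrite gt_eqF// Cmx_gt0|exact: cC].
Qed.

Lemma closed_phase_space : closed (phase_space R n).
Proof.
rewrite (_ : phase_space R n =
    (fun x : state => dot x.1 x.1) @^-1` [set y | y = 1] `&`
    (fun x : state => dot x.1 x.2) @^-1` [set y | y = 0]); last first.
  by apply/seteqP; split=> x [/enorm1].
apply: closedI; apply: preimage_closed; try exact: closed_eq; move=> x _.
  by apply: cvg_dot; exact: continuous_fst_state.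
by apply: cvg_dot; [exact: continuous_fst_state|exact: continuous_snd_state].
Qed.

Lemma compact_column_box (M : R) :
  compact [set u : 'cV[R]_n | forall i, u i 0 \in `[- M, M]].
Proof.
have := @rV_compact R n (fun=> `[- M, M]%classic) (fun=> @segment_compact _ _ _).
move=> /(continuous_compact (f := fun v : 'rV[R]_n => v^T)).
rewrite (_ : _ @` _ = [set u : 'cV[R]_n | forall i, u i 0 \in `[- M, M]]).
  apply; apply: continuous_subspaceT => v A /nbhs_ballP[e e0 eA].
  apply/nbhs_ballP; exists e => // w [_ vw]; apply: eA; split=> // i j.
  by rewrite !mxE; exact: vw.
apply/seteqP; split=> [_ [v vP <-] i|u uP]; first by rewrite mxE; exact: vP.
by exists u^T => [i|]; rewrite ?trmxK// mxE; exact: uP.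
Qed.

Lemma compact_bounded_phase (r : R) (K : set state) : closed K ->
  K `<=` phase_space R n -> (forall x, K x -> dot x.2 x.2 <= r) -> compact K.
Proof.
move=> Kcl Kph Kr.
(* Being at least 1, [M] bounds every [u_i] whose square it bounds; it serves
   for both factors, as [q] has norm 1. *)
pose M := 1 + `|r|.
have box (u : 'cV[R]_n) i : dot u u <= M -> u i 0 \in `[- M, M].
  move=> uM; have M1 : 1 <= M by rewrite lerDl.
  rewrite in_itv/= -ler_norml; have [//|Mu] := leP `|u i 0| M; exfalso.
  have : u i 0 ^+ 2 <= M.
    apply: le_trans uM; rewrite /dot (bigD1 i)//= -expr2 lerDl sumr_ge0// => j.
    by rewrite -expr2 sqr_ge0.
  rewrite -real_normK ?num_real// leNgt => /negP; apply.
  rewrite (lt_le_trans Mu)// expr2 ler_peMl//.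
  exact: le_trans (ltW Mu).
have boxc := compact_setX (@compact_column_box M) (@compact_column_box M).
apply: (subclosed_compact Kcl boxc) => x Kx; have [/enorm1 x1 _] := Kph _ Kx.
split=> i; apply: box; first by rewrite x1 lerDl.
by rewrite (le_trans (Kr _ Kx))// (le_trans (ler_norm _))// lerDr.
Qed.

(** Outside a neighbourhood of its zero set in the compact sublevel set, the
    function is bounded away from zero, so that small sublevel sets are
    invariant neighbourhoods. *)
Lemma conserved_stability (J : 'rV[R]_n) (S : set state) (r : R)
    (G : state -> R) :
  S `<=` phase_space R n -> GR_invariant J S ->
  (forall x, phase_space R n x -> G y @[y --> x] --> G x) ->
  (forall x, phase_space R n x -> 0 <= G x) ->
  (forall x, phase_space R n x -> G x = 0 <-> S x) ->
  (forall x, phase_space R n x -> dot x.2 x.2 <= r + G x) ->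
  (forall h x, GR J h -> phase_space R n x -> G (act h x) = G x) ->
  (forall (I : set R) q p, is_interval I -> solution_on J I q p ->
    forall s t, I s -> I t -> G (q s, p s) = G (q t, p t)) ->
  GR_Lyapunov_stable J S.
Proof.
move=> Sph Sinv Gcont G0 GS Gr Ginv Gcons.
split=> // U [Uph [W [Wo SW WU]]] Uinv.
pose K := [set x | phase_space R n x /\ dot x.2 x.2 <= r + 1] `&` ~` W.
have Kc : compact K.
  apply: (@compact_bounded_phase (r + 1)); last 2 first; try by move=> x [[]].
  apply: closedI; last exact: open_closedC.
  apply: (@closedI _ (phase_space R n) ((fun x => dot x.2 x.2) @^-1`
    [set y | y <= r + 1])); first exact: closed_phase_space.
  apply: preimage_closed; last exact: closed_le.
  by move=> x _; apply: cvg_dot; exact: continuous_snd_state.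
have GKc : compact (G @` K).
  apply: continuous_compact Kc; apply: continuous_in_subspaceT => x.
  by rewrite inE => -[[xph _] _]; exact: Gcont.
have [e e0 eK] : exists2 e : R, 0 < e & forall x, K x -> e <= G x.
  have GK0 : ~ (G @` K) 0.
    by move=> [x [[xph _] xW] /(GS _ xph) /SW].
  have /open_nbhs_nbhs/nbhs_ballP[e e0 eP] : open_nbhs (0 : R) (~` (G @` K)).
    split=> //; apply: closed_openC; apply: compact_closed GKc.
    exact: Rhausdorff.
  exists e => // x Kx; rewrite leNgt; apply/negP => Gxe.
  apply: (eP (G x)); last by exists x.
  rewrite /ball/= sub0r normrN ger0_norm//.
  by apply: G0; case: Kx => -[].
(* The bound by 1 keeps the sublevel set of [d] within the range of the norm
   of the momentum in [K]. *)
pose d := Num.min e 1; have d0 : 0 < d by rewrite lt_min e0 ltr01.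
pose V := [set x | phase_space R n x /\ G x < d].
have VU : V `<=` U.
  move=> x [xph]; rewrite lt_min => /andP[Gxe Gx1]; apply: WU; split=> //.
  apply: contrapT => xW; have /eK : K x; last by rewrite leNgt Gxe.
  by split=> //; split=> //; rewrite (le_trans (Gr _ xph))// lerD2l ltW.
exists V; split.
- split; first by move=> x [].
  exists [set x | G x < d]°; split; first exact: open_interior.
    move=> x Sx; have xph := Sph _ Sx.
    apply: (Gcont x xph [set y | y < d]).
    have -> : G x = 0 by apply/GS.
    exact: (@lt_nbhsl _ 0 d).
  by move=> x [/interior_subset xd xph]; split.
- move=> h hG x [xph xd]; split; last by rewrite Ginv.
  exact: (GR_phase_space hG xph).
- move=> I q p itvI oI sol [s [Is [sph sd]]] t It; apply: VU; split.
    by have [] := sol t It.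
  by rewrite -(Gcons I q p itvI sol s t Is It).
Qed.

End Topology.

(** * Extremal values of the energy *)

Section Extremal.
Context {R : realType} {n : nat} (J : 'rV[R]_n).
Implicit Types (q p u v w x y : 'cV[R]_n) (m : R).

Definition normalize p : 'cV[R]_n := (enorm p)^-1 *: p.

Lemma enorm_sqr p : enorm p ^+ 2 = dot p p.
Proof. by rewrite sqr_sqrtr// dot_ge0. Qed.

Lemma enorm_gt0 p : p != 0 -> 0 < enorm p.
Proof. by rewrite sqrtr_gt0 dot_gt0. Qed.

Lemma normalizeK p : p != 0 -> enorm p *: normalize p = p.
Proof. by move=> p0; rewrite scalerA divff ?scale1r// gt_eqF// enorm_gt0. Qed.

Lemma normalize_pair q p : dot q q = 1 -> dot q p = 0 -> p != 0 ->
  orthonormal_pair q (normalize p).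
Proof.
move=> qq qp p0; split=> //; last by rewrite dotZr qp mulr0.
by rewrite dotZl dotZr -enorm_sqr; field; rewrite gt_eqF// enorm_gt0.
Qed.

Lemma pair_inertia_normalize q p : p != 0 ->
  pair_inertia J q (normalize p) * dot p p =
  dot p (diag_mx J *m p) + dot q (diag_mx J *m q) * dot p p.
Proof.
move=> p0; rewrite -enorm_sqr /pair_inertia -scalemxAr dotZl dotZr.
by field; rewrite gt_eqF// enorm_gt0.
Qed.

Lemma pair_inertia_normalizeP q p m : p != 0 ->
  pair_inertia J q (normalize p) = m <->
  dot p (diag_mx J *m p) + dot q (diag_mx J *m q) * dot p p = m * dot p p.
Proof.
move=> p0; rewrite -pair_inertia_normalize//; split=> [->//|].
by apply: mulIf; rewrite gt_eqF// dot_gt0.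
Qed.

(** Both kinds of extremality at once. The minimal kind reduces to the maximal
    one for [- J], which has the same symmetry group. *)
Definition extremal_value m :=
  (forall i j : 'I_n, i != j -> J 0 i + J 0 j <= m) \/
  (forall i j : 'I_n, i != j -> m <= J 0 i + J 0 j).

Lemma pair_inertiaN u w : pair_inertia (- J) u w = - pair_inertia J u w.
Proof. by rewrite /pair_inertia !raddfN/= !mulNmx !dotNr opprD. Qed.

Hypothesis n_ge2 : (2 <= n)%N.

Lemma extremal_value_pairs m : extremal_value m ->
  (forall u w, orthonormal_pair u w -> pair_inertia J u w <= m) \/
  (forall u w, orthonormal_pair u w -> m <= pair_inertia J u w).
Proof.
move=> [] ext; [left|right] => u w uw.
  have [a [b ab]] := exists_two_largest J n_ge2; have [aNb _ _] := ab.
  exact: le_trans (pair_inertia_le ab uw) (ext _ _ aNb).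
have [a [b ab]] := exists_two_largest (- J) n_ge2; have [aNb _ _] := ab.
apply: le_trans (ext _ _ aNb) _.
by have := pair_inertia_le ab uw; rewrite pair_inertiaN !mxE -opprD lerN2.
Qed.

Lemma GR_opp h : GR (- J) h <-> GR J h.
Proof.
rewrite !GRP raddfN/= mulmxN mulNmx.
by split=> -[hh hJ]; split=> //; [exact: oppr_inj|rewrite hJ].
Qed.

(** The index [a] is the one whose eigenvalue stands alone at the extreme, if
    there is one; the components along [e_a] then have norm 1, and they are all
    that distinguishes two pairs up to symmetry. *)
Lemma extremal_index m u0 w0 : extremal_value m ->
  orthonormal_pair u0 w0 -> pair_inertia J u0 w0 = m ->
  exists a : 'I_n, forall u w x y,
    orthonormal_pair u w -> pair_inertia J u w = m ->
    orthonormal_pair x y -> pair_inertia J x y = m ->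
    (u a 0 ^+ 2 + w a 0 ^+ 2 = 1 -> x a 0 ^+ 2 + y a 0 ^+ 2 = 1 ->
       u a 0 = x a 0 /\ w a 0 = y a 0) ->
    exists h, [/\ GR J h, h *m u = x & h *m w = y].
Proof.
move=> ext uw0 uw0m.
suff [K [a [b [ab Km GRE]]]] : exists (K : 'rV[R]_n) a b,
    [/\ two_largest K a b,
        forall u w, pair_inertia J u w = m -> pair_inertia K u w = K 0 a + K 0 b
      & forall h, GR K h -> GR J h].
  exists a => u w x y uw uwm xy xym same.
  have [] := @extremal_pairs_conjugate _ _ K a b u w x y ab uw (Km _ _ uwm) xy
    (Km _ _ xym).
    move=> aNb; apply: same.
      by have [/(_ aNb)] := pair_inertia_eq ab uw (Km _ _ uwm).
    by have [/(_ aNb)] := pair_inertia_eq ab xy (Km _ _ xym).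
  by move=> h [hG hu hw]; exists h; split=> //; exact: GRE.
case: ext => ext.
  have [a [b ab]] := exists_two_largest J n_ge2; have [aNb _ _] := ab.
  exists J, a, b; split=> // u w ->.
  apply/eqP; rewrite eq_le ext// andbT -uw0m; exact: pair_inertia_le.
have [a [b ab]] := exists_two_largest (- J) n_ge2; have [aNb _ _] := ab.
exists (- J), a, b; split=> // [u w uwm|h /GR_opp//].
have := pair_inertia_le ab uw0; rewrite !pair_inertiaN uwm uw0m => le.
by apply/eqP; rewrite eq_le le/= !mxE -opprD lerN2 ext.
Qed.

Hypothesis J_gt0 : forall i, 0 < J 0 i.

(** The bound on the inertia of orthonormal pairs applies to [q] and the
    direction of the momentum for an upper bound, and to [q] and the direction
    of the velocity for a lower bound. *)
Lemma extremal_of_energy m q p : 0 < m -> extremal_value m ->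
  dot q q = 1 -> dot q p = 0 -> p != 0 -> m * (2 * energy J q p) = dot p p ->
  pair_inertia J q (normalize p) = m.
Proof.
move=> m0 /extremal_value_pairs ext qq qp p0 mH.
have q0 : q != 0 by rewrite -dot_gt0 qq ltr01.
apply/pair_inertia_normalizeP => //; case: ext => ext.
  apply: (inertia_eq_of_upper_bound J_gt0) => //.
  rewrite -pair_inertia_normalize// ler_wpM2r ?dot_ge0//.
  exact/ext/normalize_pair.
apply: (inertia_eq_of_lower_bound J_gt0) => //=.
have [->|v0] := eqVneq (veselova_q J q p) 0.
  by rewrite mulmx0 !dot0r !mulr0 addr0.
rewrite -pair_inertia_normalize// ler_wpM2r ?dot_ge0//.
by apply/ext/normalize_pair => //; exact: velocity_tangent.
Qed.

Lemma energy_of_velocity m q p : 0 < m -> q != 0 ->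
  veselova_q J q p = m^-1 *: p -> m * (2 * energy J q p) = dot p p.
Proof.
move=> m0 q0 vE; rewrite -dot_momentum_velocity// vE dotZr mulVKf//.
by rewrite gt_eqF.
Qed.

End Extremal.

Section Rotation.
Context {R : realType}.

Lemma unit_circle_angle (x y : R) : x ^+ 2 + y ^+ 2 = 1 ->
  exists t, cos t = x /\ sin t = y.
Proof.
move=> xy; have x1 : -1 <= x <= 1.
  rewrite -ler_norml -(ler_pXn2r (n := 2))// ?nnegrE// expr1n.
  by rewrite real_normK ?num_real// -xy lerDl sqr_ge0.
have sE : sin (acos x) = `|y|.
  by rewrite sin_acos// -xy addrC addKr sqrtr_sqr.
have cE : cos (acos x) = x by rewrite acosK// in_itv.
have [y0|y0] := leP 0 y.
  by exists (acos x); rewrite cE sE ger0_norm.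
by exists (- acos x); rewrite cosN sinN cE sE ltr0_norm// opprK.
Qed.

(** In the frame that rotates with the solution both coordinates are constant,
    and the rotation reaches every angle. *)
Lemma rotation_onto_circle (Q P : R -> R) (om : R) : om != 0 ->
  (forall t : R, is_derive t 1 Q (om * P t)) ->
  (forall t : R, is_derive t 1 P (- om * Q t)) ->
  Q 0 ^+ 2 + P 0 ^+ 2 = 1 ->
  forall x y, x ^+ 2 + y ^+ 2 = 1 -> exists t, Q t = x /\ P t = y.
Proof.
move=> om0 dQ dP QP0 x y xy.
have [th [cth sth]] : exists t, cos t = x * Q 0 + y * P 0 /\
    sin t = x * P 0 - y * Q 0.
  apply: unit_circle_angle; rewrite -[1](mulr1 1) -{1}QP0 -xy; ring.
pose t := th / om; have omt : om * t = th by rewrite mulrC divfK.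
have dom (s : R) : is_derive s 1 (fun r => om * r) om.
  apply: is_derive_cong (is_derive_mul (is_derive_cst om s 1)
    (is_derive_id s 1)) _.
  by rewrite mul0r add0r mulr1.
have dc (s : R) : is_derive s 1 (fun r => cos (om * r)) (- sin (om * s) * om).
  by apply: is_derive_cong (is_derive1_comp (is_derive_cos _) (dom s)) _.
have ds (s : R) : is_derive s 1 (fun r => sin (om * r)) (cos (om * s) * om).
  by apply: is_derive_cong (is_derive1_comp (is_derive_sin _) (dom s)) _.
have e1 : Q t * cos (om * t) - P t * sin (om * t) = Q 0.
  have dF s := is_derive_sub (is_derive_mul (dQ s) (dc s))
    (is_derive_mul (dP s) (ds s)).
  have -> : Q t * cos (om * t) - P t * sin (om * t) =
      Q 0 * cos (om * 0) - P 0 * sin (om * 0).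
    apply: (is_derive_0_is_cst
      (f := fun s => Q s * cos (om * s) - P s * sin (om * s))) => s.
    by apply: is_derive_cong (dF s) _; ring.
  by rewrite mulr0 cos0 sin0 mulr1 mulr0 subr0.
have e2 : Q t * sin (om * t) + P t * cos (om * t) = P 0.
  have dF s := is_derive_add (is_derive_mul (dQ s) (ds s))
    (is_derive_mul (dP s) (dc s)).
  have -> : Q t * sin (om * t) + P t * cos (om * t) =
      Q 0 * sin (om * 0) + P 0 * cos (om * 0).
    apply: (is_derive_0_is_cst
      (f := fun s => Q s * sin (om * s) + P s * cos (om * s))) => s.
    by apply: is_derive_cong (dF s) _; ring.
  by rewrite mulr0 cos0 sin0 mulr1 mulr0 add0r.
exists t; move: e1 e2 (cos2Dsin2 th); rewrite omt => e1 e2 cs.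
split.
  transitivity (Q 0 * cos th + P 0 * sin th).
    by rewrite -e1 -e2 -[LHS]mulr1 -cs; ring.
  by rewrite cth sth -[RHS]mulr1 -QP0; ring.
transitivity (P 0 * cos th - Q 0 * sin th).
  by rewrite -e1 -e2 -[LHS]mulr1 -cs; ring.
by rewrite cth sth -[RHS]mulr1 -QP0; ring.
Qed.

End Rotation.

(** * Steady rotations *)

Section SteadyRotation.
Context {R : realType} {n : nat} (J : 'rV[R]_n).
Hypothesis J_gt0 : forall i, 0 < J 0 i.
Variables (q p : R -> 'cV[R]_n) (Pi : 'M[R]_n).
Hypothesis steady : steady_rotation J q p.
Hypothesis principal : principal_plane J Pi.
Hypothesis in_plane : takes_place_in q p Pi.

Let m := plane_inertia J Pi.

Lemma solution_on_phase (I : set R) (c e : R -> 'cV[R]_n) t :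
  solution_on J I c e -> I t -> dot (c t) (c t) = 1 /\ dot (c t) (e t) = 0.
Proof. by move=> sol It; have [[/enorm1]] := sol t It. Qed.

Lemma conserved_momentum_norm (I : set R) (c e : R -> 'cV[R]_n) :
  is_interval I -> solution_on J I c e -> forall s t, I s -> I t ->
  dot (e s) (e s) = dot (e t) (e t).
Proof.
move=> itvI sol s t Is It; apply: (constant_on_interval (f := fun r => dot (e r) (e r)) itvI _ Is It).
move=> r Ir.
have [_ ce0] := solution_on_phase sol Ir; have [_ _ dE] := sol r Ir.
exact: is_derive_momentum_norm ce0 dE.
Qed.

Lemma conserved_energy (I : set R) (c e : R -> 'cV[R]_n) :
  is_interval I -> solution_on J I c e -> forall s t, I s -> I t ->
  2 * energy J (c s) (e s) = 2 * energy J (c t) (e t).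
Proof.
move=> itvI sol s t Is It; apply: (constant_on_interval
  (f := fun r => 2 * energy J (c r) (e r)) itvI _ Is It) => r Ir.
have [cc ce] := solution_on_phase sol Ir; have [_ dC dE] := sol r Ir.
exact: (is_derive_energy J_gt0 cc ce dC dE).
Qed.

Let sol : solution_on J [set: R] q p. Proof. by case: steady. Qed.
Let qq t : dot (q t) (q t) = 1.
Proof. by have [] := solution_on_phase sol (I : [set: R] t). Qed.
Let qp t : dot (q t) (p t) = 0.
Proof. by have [] := solution_on_phase sol (I : [set: R] t). Qed.
Let q0 t : q t != 0. Proof. by rewrite -dot_gt0 qq ltr01. Qed.

Lemma steady_momentum_norm t : dot (p t) (p t) = dot (p 0) (p 0).
Proof. by apply: (conserved_momentum_norm _ sol). Qed.

(** A vanishing momentum would give an equilibrium, whose angular velocity is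
    zero. *)
Lemma steady_momentum_neq0 t : p t != 0.
Proof.
rewrite -dot_gt0 steady_momentum_norm dot_gt0; apply/eqP => p0.
have pt s : p s = 0.
  by apply/eqP; rewrite -dot_eq0 steady_momentum_norm p0 dot0l.
case: steady => _ [Om [/eqP Om0 OmE]]; apply: Om0; rewrite -(OmE 0).
have [_ [_ dq] _] := sol (I : [set: R] 0).
rewrite /angular_velocity derive1E dq pt veselova_qE /multiplier dot0l mul0r.
by rewrite scale0r subrr mulmx0 trmx0 mulmx0 mul0mx subrr.
Qed.

Let pN0 t : p t != 0 := steady_momentum_neq0 t.

Lemma steady_pair t : orthonormal_pair (q t) (normalize (p t)).
Proof. exact: normalize_pair. Qed.

Let momentum_direction t : ((normalize (p t))^T <= Pi)%MS.
Proof. by rewrite linearZ/= scalemx_sub//; have [] := in_plane t. Qed.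

Lemma steady_pair_inertia t : pair_inertia J (q t) (normalize (p t)) = m.
Proof.
have [qPi _] := in_plane t.
by rewrite /m (plane_inertia_pair principal (steady_pair t)).
Qed.

Lemma steady_inertia_gt0 : 0 < m.
Proof.
rewrite -(steady_pair_inertia 0); apply: ltr_wpDr.
  by apply: jdot_ge0 => i; exact: ltW.
rewrite lt_neqAle jdot_ge0 ?andbT => [|i]; last exact: ltW.
by apply: contra_neq (q0 0) => /esym /(jdot_eq0 J_gt0).
Qed.

(** As the plane is invariant, [J p] is a combination of [q] and [p] whose
    [p]-component is determined by the moment of inertia. *)
Lemma steady_velocity t : veselova_q J (q t) (p t) = m^-1 *: p t.
Proof.
have [qPi pPi] := in_plane t; have [rk st] := principal.
have JpPi : ((diag_mx J *m p t)^T <= Pi)%MS.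
  by rewrite trmx_mul tr_diag_mx (submx_trans (submxMr _ pPi)).
have := plane_expansion rk (steady_pair t) qPi (momentum_direction t) JpPi.
set b := dot (q t) _ => JpE.
apply: (@velocity_principal _ _ _ J_gt0 _ _ _ b) => //.
  exact: steady_inertia_gt0.
have /pair_inertia_normalizeP := steady_pair_inertia t.
move=> /(_ (pN0 t)); rewrite [X in dot (p t) X]JpE => e.
rewrite JpE -addrA addrC; congr (_ + _).
rewrite /normalize scalerA -scalerDl; congr (_ *: _).
have pp0 : dot (p t) (p t) != 0 by rewrite dot_eq0.
have e0 : enorm (p t) != 0 by rewrite gt_eqF// enorm_gt0.
apply: (mulIf pp0); rewrite -e mulrDl; congr (_ + _).
rewrite [in RHS]dotDr [in RHS]dotZr (dotC _ (q t)) qp mulr0 add0r dotZr dotZr.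
by rewrite mulrA.
Qed.

Lemma steady_energy t : m * (2 * energy J (q t) (p t)) = dot (p t) (p t).
Proof. exact: energy_of_velocity steady_inertia_gt0 (q0 t) (steady_velocity t). Qed.

(** As [q' = p / m] and [p' = - (|p|^2 / m) q], the components of the pair along
    any axis turn at the constant rate [|p| / m], hence run through the whole
    circle. *)
Lemma steady_coordinates (a : 'I_n) x y :
  q 0 a 0 ^+ 2 + normalize (p 0) a 0 ^+ 2 = 1 -> x ^+ 2 + y ^+ 2 = 1 ->
  exists t, q t a 0 = x /\ normalize (p t) a 0 = y.
Proof.
pose c := enorm (p 0); have c_gt0 : 0 < c by rewrite enorm_gt0.
have m0 := steady_inertia_gt0.
have normE t : enorm (p t) = c by rewrite /enorm steady_momentum_norm.
have dq (t : R) : is_derive t 1 (fun s => q s a 0) (c / m * normalize (p t) a 0).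
  have [_ dqt _] := sol (I : [set: R] t).
  apply: is_derive_cong (is_derive_coord a dqt) _.
  rewrite steady_velocity /normalize normE !mxE.
  by field; rewrite !gt_eqF.
have dp (t : R) : is_derive t 1 (fun s => normalize (p s) a 0) (- (c / m) * q t a 0).
  have [_ _ dpt] := sol (I : [set: R] t).
  rewrite (_ : (fun s => _) = fun s => c^-1 * p s a 0); last first.
    by apply/funext => s; rewrite /normalize normE mxE.
  apply: is_derive_cong (is_derive_mul (is_derive_cst c^-1 t 1)
    (is_derive_coord a dpt)) _.
  have := steady_energy t; rewrite -enorm_sqr normE => mH.
  rewrite /cst mxE; have -> : 2 * energy J (q t) (p t) = c ^+ 2 / m.
    by rewrite -mH; field; rewrite gt_eqF.
  by field; rewrite !gt_eqF.
have om0 : c / m != 0 by rewrite mulf_neq0 ?invr_eq0// gt_eqF.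
by move=> qp1 xy; have := rotation_onto_circle om0 dq dp qp1 xy.
Qed.

End SteadyRotation.

Theorem theorem3p12 (R : realType) (n : nat) (J : 'rV[R]_n)
  (hn : (2 <= n)%N) (hJ : forall i : 'I_n, 0 < J 0 i)
  (q p : R -> 'cV[R]_n) (Pi : 'M[R]_n)
  (hsteady : steady_rotation J q p)
  (hextremal : extremal_plane J Pi)
  (hplane : takes_place_in q p Pi) :
  GR_Lyapunov_stable J (GR_orbit J q p).
Proof.
have [principal ext] := hextremal; set m := plane_inertia J Pi in ext.
have m0 : 0 < m := steady_inertia_gt0 hJ hsteady principal hplane.
have extm : extremal_value J m.
  case: ext => ext; [right|left] => i j ij;
  by have [Pi' PiP <-] := coordinate_plane J ij; exact: ext.
have sol : solution_on J [set: R] q p by case: hsteady.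
have pN0 t : p t != 0 := steady_momentum_neq0 hsteady t.
have pair := steady_pair hsteady.
have pairm := steady_pair_inertia hsteady principal hplane.
have Hm := steady_energy hJ hsteady principal hplane.
pose c2 := dot (p 0) (p 0).
have pc2 t : dot (p t) (p t) = c2 := steady_momentum_norm hsteady t.
pose G (x : 'cV[R]_n * 'cV[R]_n) : R :=
  `|dot x.2 x.2 - c2| + `|m * (2 * energy J x.1 x.2) - dot x.2 x.2|.
apply: (@conserved_stability _ _ _ _ c2 G).
- move=> x [h [t [hG ->]]]; apply: GR_phase_space hG _.
  by have [] := sol t I.
- move=> h hG x [k [t [kG ->]]]; exists (h *m k), t; split; first exact: GRM.
  by rewrite /act/= !mulmxA.
- move=> x [/enorm1 xx _]; have x0 : x.1 != 0 by rewrite -dot_gt0 xx ltr01.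
  have cpp : dot y.2 y.2 @[y --> x] --> dot x.2 x.2.
    by apply: cvg_dot; exact: continuous_snd_state.
  apply: cvgD; apply: cvg_norm; apply: cvgB => //; first exact: cvg_cst.
  apply: cvgM; first exact: cvg_cst.
  apply: cvgM; [exact: cvg_cst|exact: continuous_energy].
- by move=> x _; rewrite addr_ge0.
- move=> x [/enorm1 xx xy]; split=> [/eqP|[h [t [hG ->]]]]; last first.
    by rewrite /G/= !(GR_dot _ _ hG) GR_energy// pc2 Hm pc2 subrr normr0 addr0.
  rewrite paddr_eq0// !normr_eq0 !subr_eq0 => /andP[/eqP yc /eqP yH].
  have y0 : x.2 != 0 by rewrite -dot_gt0 yc dot_gt0.
  have xypair := normalize_pair xx xy y0.
  have xym := extremal_of_energy hn hJ m0 extm xx xy y0 yH.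
  have [a aP] := extremal_index hn extm (pair 0) (pairm 0).
  have same_norm t : enorm x.2 = enorm (p t) by rewrite /enorm yc pc2.
  suff [t [h [hG hq hp]]] : exists t h,
      [/\ GR J h, h *m q t = x.1 & h *m normalize (p t) = normalize x.2].
    exists h, t; split=> //; rewrite [LHS]surjective_pairing /act/= hq.
    by rewrite -(normalizeK (pN0 t)) -scalemxAr hp -same_norm normalizeK.
  (* When the components along [e_a] of both pairs have norm 1, the steady
     rotation is followed until they agree; otherwise any time will do. *)
  have [xya|xya] := pselect (x.1 a 0 ^+ 2 + normalize x.2 a 0 ^+ 2 = 1); last first.
    by exists 0; apply: aP => // _ /xya.
  have [qpa|qpa] := pselect (q 0 a 0 ^+ 2 + normalize (p 0) a 0 ^+ 2 = 1);
    last first.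
    by exists 0; apply: aP => // /qpa.
  have [t [qt pt]] := steady_coordinates hJ hsteady principal hplane qpa xya.
  by exists t; apply: aP.
- by move=> x _; rewrite /G addrA ler_wpDr// -lerBlDl ler_norm.
- by move=> h x hG _; rewrite /G/= !(GR_dot _ _ hG) GR_energy.
- move=> I c e itvI csol s t Is It; rewrite /G/=.
  rewrite (conserved_momentum_norm itvI csol Is It).
  by rewrite (conserved_energy hJ itvI csol Is It).
Qed.
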